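(* For all integers $d\geq1$ and $n\geq1$, the sequence $D(d,n,0),D(d,n,1),\dots,D(d,n,d)$ is log-concave, i.e. $$D(d,n,k)^2\geq D(d,n,k-1)\,D(d,n,k+1)\qquad\text{for all } 1\leq k\leq d-1.$$
   Context: $S_d$ denotes the symmetric group on $\{1,\dots,d\}$, permutations being written as words $a_1a_2\cdots a_d$. Indexed permutations: for $n\geq1$, $S_d^n$ is the set of pairs $(a,z)$ where $a=a_1\cdots a_d\in S_d$ and $z=(z_1,\dots,z_d)\in\{0,1,\dots,n-1\}^d$ (each letter $a_i$ is assigned the index $z_i$). A descent of $(a,z)$ is an $i\in\{1,\dots,d\}$ such that $z_i>z_{i+1}$, or $z_i=z_{i+1}$ and $a_i>a_{i+1}$, with the convention $a_{d+1}=d+1$, $z_{d+1}=0$. $D(d,n,k)$ is the number of elements of $S_d^n$ with exactly $k$ descents. (The descent polynomial is $D_d^n(t)=\sum_{k=0}^d D(d,n,k)t^k$.) *)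

(* Defs.v *)
From mathcomp Require Import all_boot all_fingroup.

Set Implicit Arguments.
Unset Strict Implicit.
Unset Printing Implicit Defensive.

(* Positions 1, ..., d are represented by 0, ..., d - 1 : 'I_d, so the extra
   position d + 1 of the convention a_(d+1) = d + 1, z_(d+1) = 0 is d here.
   Letters 'I_d are shifted by one so that they range over {1, ..., d}. *)

Definition indexed_perm (d n : nat) : finType :=
  ('S_d * {ffun 'I_d -> 'I_n})%type.

Definition letter (d n : nat) (w : indexed_perm d n) (i : nat) : nat :=
  if (insub i : option 'I_d) is Some j then (w.1 j).+1 else d.+1.

Definition index_at (d n : nat) (w : indexed_perm d n) (i : nat) : nat :=
  if (insub i : option 'I_d) is Some j then w.2 j else 0.

Definition is_descent (d n : nat) (w : indexed_perm d n) (i : 'I_d) : bool :=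
  (index_at w i > index_at w i.+1)
  || ((index_at w i == index_at w i.+1) && (letter w i > letter w i.+1)).

Definition num_descents (d n : nat) (w : indexed_perm d n) : nat :=
  #|[set i : 'I_d | is_descent w i]|.

Definition D (d n k : nat) : nat :=
  #|[set w : indexed_perm d n | num_descents w == k]|.

(* Main.v *)
Require Import Defs.
From mathcomp Require Import all_boot all_fingroup.
From mathcomp Require Import zify.

Set Implicit Arguments.
Unset Strict Implicit.
Unset Printing Implicit Defensive.

(** Every indexed permutation of d+1 letters arises exactly once by inserting
the largest letter, with an arbitrary index c, into an arbitrary gap of an
indexed permutation w of d letters ([insert_max_bij]).  Such an insertion
creates either no descent or exactly one.  In a gap between consecutive indices
t and t', the number of c that create no descent is t' - t, increased by n if
the gap is a descent of w.  Summed over the d+1 gaps, the differences telescope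
to 1: exactly n des(w) + 1 of the n (d+1) insertions create no descent
([sum_new_descentC]).  Here the leftmost boundary counts as index 0 and the
sentinel at the right end as index 1.  Counting gives the recurrence
([D_succ])
   D(d+1,n,k) = (nk+1) D(d,n,k) + (n(d+1) - n(k-1) - 1) D(d,n,k-1).

Log-concavity then follows by induction on d.  The coefficients are arithmetic
progressions in k, of differences n and -n, so that the gap in the inequality
for d+1 is a nonnegative combination of the gaps of the inequalities
a(k-1) a(k+1) <= a(k)^2 and a(k-2) a(k+1) <= a(k-1) a(k) for d, and of the
square n^2 (a(k) - a(k-1))^2 ([log_concave_step]).  The second kind of
inequality is a consequence of log-concavity when every term after a zero is
zero, a property which passes from d to d+1 because nk+1 > 0. *)

(** * Descents after inserting a letter *)

Section Insertion.

Variables (T : Type) (r : rel T).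

Definition desc (u : nat -> T) (d : nat) : nat :=
  \sum_(0 <= j < d) r (u j) (u j.+1).

Definition insert (i : nat) (x : T) (u : nat -> T) (j : nat) : T :=
  if j < i then u j else if j == i then x else u j.-1.

Lemma insert_lt i x u j : j < i -> insert i x u j = u j.
Proof. by rewrite /insert => ->. Qed.

Lemma insert_eq i x u : insert i x u i = x.
Proof. by rewrite /insert ltnn eqxx. Qed.

Lemma insert_gt i x u j : i < j -> insert i x u j = u j.-1.
Proof. by move=> lt_ij; rewrite /insert (gtn_eqF lt_ij) ltnNge ltnW. Qed.

(** Only the gap receiving [x] is affected: the comparison of its two sides is
replaced by the comparisons of each side with [x].  It is moved to the left so
that no subtraction occurs; at [i = 0] there is no left side. *)
Lemma desc_insert (u : nat -> T) (x : T) (i d : nat) : i <= d ->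
  desc (insert i x u) d.+1 + ((0 < i) && r (u i.-1) (u i)) =
  desc u d + ((0 < i) && r (u i.-1) x) + r x (u i).
Proof.
move=> le_id; rewrite /desc.
rewrite (@big_cat_nat _ _ _ i) //=; last exact: leqW.
rewrite (@big_ltn _ _ _ i) //= (@big_cat_nat _ _ _ i 0 d) //=.
have ->: \sum_(i.+1 <= j < d.+1) r (insert i x u j) (insert i x u j.+1)
       = \sum_(i <= j < d) r (u j) (u j.+1).
  rewrite big_add1 /= big_nat_cond [RHS]big_nat_cond.
  apply: eq_bigr => j /andP[/andP[le_ij _] _].
  by rewrite !insert_gt // ltnS ltnW.
have ->: r (insert i x u i) (insert i x u i.+1) = r x (u i).
  by rewrite insert_eq insert_gt.
have E k : k < i ->
  \sum_(0 <= j < k) r (insert i x u j) (insert i x u j.+1) =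
  \sum_(0 <= j < k) r (u j) (u j.+1).
  move=> lt_ki; rewrite big_nat_cond [RHS]big_nat_cond.
  apply: eq_bigr => j /andP[/andP[_ lt_jk] _].
  by rewrite !insert_lt // ?(ltn_trans lt_jk) // (leq_ltn_trans lt_jk).
case: i le_id E => [|i] _ E.
  by rewrite !(@big_geq _ _ _ 0 0) //=; lia.
rewrite !big_nat_recr //= E // insert_eq insert_lt //.
lia.
Qed.

End Insertion.

(** * Indexed permutations as words of pairs (index, letter) *)

Definition lexgt (p q : nat * nat) : bool :=
  (q.1 < p.1) || ((p.1 == q.1) && (q.2 < p.2)).

(** The sentinel letter [N] is a parameter because only its being larger than
all the letters matters for descents: words of d and of d+1 letters can then
share one sentinel. *)
Definition word (N d n : nat) (w : indexed_perm d n) (j : nat) : nat * nat :=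
  if insub j is Some k then (w.2 k : nat, (w.1 k).+1) else (0, N).

Lemma word_ord N d n (w : indexed_perm d n) (j : 'I_d) :
  word N w j = (w.2 j : nat, (w.1 j).+1).
Proof. by rewrite /word valK. Qed.

Lemma word_out N d n (w : indexed_perm d n) j : d <= j -> word N w j = (0, N).
Proof. by move=> le_dj; rewrite /word insubN // -leqNgt. Qed.

Lemma num_descents_word N d n (w : indexed_perm d n) : d < N ->
  num_descents w = desc lexgt (word N w) d.
Proof.
move=> lt_dN; rewrite /num_descents -sum1dep_card big_mkcond /= /desc big_mkord.
apply: eq_bigr => i _.
have ->: is_descent w i = lexgt (word N w i) (word N w i.+1).
  rewrite /is_descent /lexgt /index_at /letter word_ord valK /=.
  case: (ltnP i.+1 d) => lt_id.
    by rewrite -[i.+1]/(val (Ordinal lt_id)) word_ord valK.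
  rewrite word_out // insubN -?leqNgt //=.
  move: (w.1 i) (ltn_ord (w.1 i)) => a lt_ad; lia.
by case: lexgt.
Qed.

(** * Inserting the largest letter *)

Definition insert_max (d n : nat) (p : ('I_d.+1 * 'I_n) * indexed_perm d n)
    : indexed_perm d.+1 n :=
  (lift_perm p.1.1 ord_max p.2.1,
   [ffun j => if unlift p.1.1 j is Some k then p.2.2 k else p.1.2]).

Lemma insert_max_inj d n : injective (@insert_max d n).
Proof.
move=> [[i c] [s z]] [[i' c'] [s' z']] [] /= eq_s /ffunP eq_z.
(* The insertion position is where the maximal letter sits. *)
have eq_i : i = i'.
  apply: (@perm_inj _ (lift_perm i ord_max s)).
  by rewrite [in RHS]eq_s !lift_perm_id.
subst i'; congr (_, _, (_, _)).
- by have := eq_z i; rewrite !ffunE unlift_none.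
- apply/permP=> k; apply: (@lift_inj _ ord_max).
  by rewrite -!(lift_perm_lift i) eq_s.
- by apply/ffunP=> k; have := eq_z (lift i k); rewrite !ffunE liftK.
Qed.

Lemma insert_max_bij d n : bijective (@insert_max d n).
Proof.
apply: (inj_card_bij (@insert_max_inj d n)).
rewrite !card_prod !card_ffun !card_ord.
have cS m : #|{: 'S_m}| = m`!.
  by rewrite -(card_Sn m); apply: eq_card => s; rewrite !inE.
by rewrite !cS factS expnS; lia.
Qed.

Lemma word_insert_max N d n i c (w : indexed_perm d n) :
  word N (insert_max (i, c, w)) =1 insert i (c : nat, d.+1) (word N w).
Proof.
move=> j; case: (ltnP j d.+1) => [lt_jd|le_dj]; last first.
  have lt_ij := leq_trans (ltn_ord i) le_dj.
  by rewrite insert_gt // !word_out //; lia.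
rewrite -[j]/(val (Ordinal lt_jd)) word_ord /= ffunE.
case: (unliftP i (Ordinal lt_jd)) => [k|] ej; last first.
  by rewrite [X in insert _ _ _ X](_ : j = i) -?ej // ej insert_eq lift_perm_id.
rewrite [X in insert _ _ _ X](_ : j = bump i k);
  last by rewrite -[LHS]/(val (Ordinal lt_jd)) ej.
rewrite ej lift_perm_lift lift_max.
rewrite /bump; case: (leqP i k) => le_ik /=.
  by rewrite insert_gt ?ltnS // word_ord.
by rewrite add0n insert_lt // word_ord.
Qed.

(** * Which insertions create a descent *)

(** The largest letter with index c exceeds the entry at position j exactly when
c is at least the index of that entry; for the sentinel, which has index 0 but
an even larger letter, c has to be at least 1.  These bounds are shifted by one
position and preceded by 0, as though an entry of index 0 stood on the left:
gap i then lies between [threshold w i] and [threshold w i.+1]. *)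
Definition threshold (d n : nat) (w : indexed_perm d n) (i : nat) : nat :=
  if i is j.+1 then (if j < d then (word 0 w j).1 else 1) else 0.

Lemma threshold_le d n (w : indexed_perm d n) i : 0 < n -> threshold w i <= n.
Proof.
move=> n0; case: i => //= j; case: (ltnP j d) => // lt_jd.
by rewrite -[j]/(val (Ordinal lt_jd)) word_ord /= ltnW // ltn_ord.
Qed.

Lemma lexgt_max_word d n (w : indexed_perm d n) c j :
  lexgt (c, d.+1) (word d.+2 w j) = (threshold w j.+1 <= c).
Proof.
rewrite /lexgt /=; case: (ltnP j d) => [lt_jd|le_dj].
  rewrite !(word_ord _ w (Ordinal lt_jd)) /=.
  by move: (w.1 _) (ltn_ord (w.1 (Ordinal lt_jd))) => a lt_ad; lia.
by rewrite word_out //=; lia.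
Qed.

Lemma lexgt_word_max d n (w : indexed_perm d n) c j :
  lexgt (word d.+2 w j) (c, d.+1) = (c < threshold w j.+1).
Proof.
rewrite /lexgt /=; case: (ltnP j d) => [lt_jd|le_dj].
  rewrite !(word_ord _ w (Ordinal lt_jd)) /=.
  by move: (w.1 _) (ltn_ord (w.1 (Ordinal lt_jd))) => a lt_ad; lia.
by rewrite word_out //=; lia.
Qed.

Definition gap_descent (d n : nat) (w : indexed_perm d n) (i : nat) : bool :=
  (0 < i) && lexgt (word d.+2 w i.-1) (word d.+2 w i).

(** Letters break ties between equal indices, but thresholds move weakly in the
direction of the word.  At the right end this uses that an index exceeds that
of the sentinel exactly when it is at least 1. *)
Lemma threshold_gap d n (w : indexed_perm d n) i : i <= d ->
  if gap_descent w i then threshold w i.+1 <= threshold w i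
  else threshold w i <= threshold w i.+1.
Proof.
rewrite /gap_descent; case: i => [|i] // lt_id.
rewrite /lexgt /= lt_id; case: (ltnP i.+1 d) => [lt_iSd|le_diS].
  rewrite !(word_ord _ w (Ordinal lt_id)) !(word_ord _ w (Ordinal lt_iSd)) /=.
  by case: ifP; lia.
rewrite [word _ w i.+1]word_out //.
rewrite !(word_ord _ w (Ordinal lt_id)) /=.
move: (w.1 _) (ltn_ord (w.1 (Ordinal lt_id))) => a lt_ad.
by case: ifP; lia.
Qed.

(** The two new comparisons have truth values A and B, and the number of
descents gained is A + B minus that of the gap; by [threshold_gap] this is 0 or
1, hence its form as a boolean. *)
Definition new_descent (d n : nat) (w : indexed_perm d n)
    (p : 'I_d.+1 * 'I_n) : bool :=
  let A := p.2 < threshold w p.1 in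
  let B := threshold w p.1.+1 <= p.2 in
  if gap_descent w p.1 then A && B else A || B.

Lemma new_descentE d n (w : indexed_perm d n) p :
  new_descent w p + gap_descent w p.1 =
  (p.2 < threshold w p.1) + (threshold w p.1.+1 <= p.2).
Proof.
have := threshold_gap w (ltn_ord p.1); rewrite /new_descent.
by case: gap_descent; lia.
Qed.

Lemma num_descents_insert_max d n (w : indexed_perm d n) p :
  num_descents (insert_max (p, w)) = num_descents w + new_descent w p.
Proof.
case: p => i c.
have le_id : i <= d by rewrite -ltnS.
rewrite (@num_descents_word d.+2) // (@num_descents_word d.+2 _ _ w) //.
have ->: desc lexgt (word d.+2 (insert_max (i, c, w))) d.+1 =
    desc lexgt (insert i (c : nat, d.+1) (word d.+2 w)) d.+1.
  by apply: eq_bigr => j _; rewrite !word_insert_max.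
have := desc_insert lexgt (word d.+2 w) (c : nat, d.+1) le_id.
have ->: (0 < i) && lexgt (word d.+2 w i.-1) (c : nat, d.+1) =
    (c < threshold w i).
  by case: (nat_of_ord i) => // j; rewrite lexgt_word_max.
by rewrite lexgt_max_word -addnA -(new_descentE w (i, c)) addnA => /addIn.
Qed.

(** * Counting the insertions *)

Lemma sum_ltn_ord n t : t <= n -> \sum_(c < n) (c < t) = t.
Proof.
move=> le_tn; rewrite (eq_bigr (fun c : 'I_n => if c < t then 1 else 0));
  last by move=> c _; case: ltnP.
by rewrite -big_mkcond /= -(big_ord_widen n (fun=> 1)) // sum1_card card_ord.
Qed.

Lemma sum_geq_ord n t : t <= n -> \sum_(c < n) (t <= c) + t = n.
Proof.
move=> le_tn; rewrite -{2}(sum_ltn_ord le_tn) -big_split /=.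
rewrite (eq_bigr (fun=> 1)) ?sum1_card ?card_ord // => c _.
by case: ltnP.
Qed.

(** Summed over the indices c, the identity [new_descentE] gives
[threshold w i + n - threshold w i.+1]; summed over the gaps, the thresholds
telescope from 0 to 1. *)
Lemma sum_new_descent d n (w : indexed_perm d n) : 0 < n ->
  \sum_p new_descent w p + (n * num_descents w).+1 = n * d.+1.
Proof.
move=> n0.
have gap (i : 'I_d.+1) :
    \sum_(c < n) new_descent w (i, c) + n * gap_descent w i + threshold w i.+1 =
    threshold w i + n.
  have := sum_ltn_ord (threshold_le w i n0).
  have := sum_geq_ord (threshold_le w i.+1 n0).
  have: \sum_(c < n) (new_descent w (i, c) + gap_descent w i) =
      \sum_(c < n) ((c < threshold w i) + (threshold w i.+1 <= c)).
    by apply: eq_bigr => c _; rewrite -(new_descentE w (i, c)).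
  by rewrite !big_split /= sum_nat_const card_ord; lia.
have: \sum_(i < d.+1) (\sum_(c < n) new_descent w (i, c) +
    n * gap_descent w i + threshold w i.+1) =
    \sum_(i < d.+1) (threshold w i + n).
  by apply: eq_bigr => i _; apply: gap.
rewrite !big_split /= sum_nat_const card_ord -big_distrr /=.
rewrite pair_bigA /= (eq_bigr (fun p => nat_of_bool (new_descent w p)));
  last by case.
have ->: \sum_(i < d.+1) gap_descent w i = num_descents w.
  by rewrite big_ord_recl /= (@num_descents_word d.+2) // /desc big_mkord.
have: \sum_(i < d.+1) threshold w i.+1 = (\sum_(i < d.+1) threshold w i).+1.
  rewrite big_ord_recr big_ord_recl /= ltnn addn1 add0n.
  by congr _.+1; apply: eq_bigr.
move=> -> total; apply: (@addnI (\sum_(i < d.+1) threshold w i)).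
by rewrite [n * d.+1]mulnC -total !addnS addnC.
Qed.

Lemma sum_new_descentC d n (w : indexed_perm d n) : 0 < n ->
  \sum_p ~~ new_descent w p = (n * num_descents w).+1.
Proof.
move=> n0; have := sum_new_descent w n0.
have: \sum_p (new_descent w p + ~~ new_descent w p) = d.+1 * n.
  rewrite (eq_bigr (fun=> 1)); last by move=> p _; case: new_descent.
  by rewrite sum1_card card_prod !card_ord.
rewrite big_split /= [d.+1 * n]mulnC -(sum_new_descent w n0).
by move=> /addnI.
Qed.

(** * The recurrence *)

Lemma D_sum d n k : D d n k = \sum_(w : indexed_perm d n) (num_descents w == k).
Proof.
rewrite /D -sum1dep_card big_mkcond /=.
by apply: eq_bigr => w _; case: eqP.
Qed.

Lemma sum_num_descents_insert_max d n (w : indexed_perm d n) k : 0 < n ->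
  \sum_p (num_descents (insert_max (p, w)) == k) =
    (n * k).+1 * (num_descents w == k) +
    (if k is j.+1 then (n * d.+1 - (n * j).+1) * (num_descents w == j) else 0).
Proof.
move=> n0.
have ->: \sum_p (num_descents (insert_max (p, w)) == k) =
    (num_descents w == k) * \sum_p ~~ new_descent w p +
    ((num_descents w).+1 == k) * \sum_p new_descent w p.
  rewrite !big_distrr -big_split /=; apply: eq_bigr => p _.
  rewrite num_descents_insert_max.
  by case: new_descent; rewrite ?addn0 ?addn1 muln0 muln1 ?addn0.
rewrite (sum_new_descentC w n0) -(sum_new_descent w n0).
congr (_ + _); first by rewrite mulnC; case: eqP => [->|]; rewrite ?muln0.
case: k => [|k] //; rewrite eqSS mulnC.
by case: eqP => [->|]; rewrite ?muln0 // addnK.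
Qed.

Lemma D_succ d n k : 0 < n ->
  D d.+1 n k =
    (n * k).+1 * D d n k +
    (if k is j.+1 then (n * d.+1 - (n * j).+1) * D d n j else 0).
Proof.
move=> n0; rewrite D_sum (reindex _ (onW_bij _ (@insert_max_bij d n))) /=.
transitivity (\sum_(w : indexed_perm d n)
    \sum_p (num_descents (insert_max (p, w)) == k)).
  by rewrite exchange_big pair_bigA /=; apply: eq_bigr => -[].
rewrite (eq_bigr _ (fun w _ => sum_num_descents_insert_max w k n0)).
rewrite big_split /= -big_distrr -D_sum.
by case: k => [|k]; rewrite ?big1_eq // -big_distrr -D_sum.
Qed.

Lemma D_gt d n k : d < k -> D d n k = 0.
Proof.
move=> lt_dk; rewrite D_sum big1 // => w _.
have := max_card (mem [set i : 'I_d | is_descent w i]).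
rewrite card_ord -/(num_descents w); case: eqP => // ->.
by rewrite leqNgt lt_dk.
Qed.

(** * Log-concavity *)

(** With [p, q, r, s] consecutive terms of the old sequence, and [b], [b + n],
[b + 2 * n] and [c + 2 * n], [c + n], [c] the coefficients of the recurrence,
the two factors on the left and the base on the right are consecutive terms of
the new sequence.  The right side minus the left side equals
   b (b + 2n) (r^2 - qs) + c (c + 2n) (q^2 - pr)
   + (b + 2n) (c + 2n) (qr - ps) + n^2 (r - q)^2. *)
Lemma log_concave_step (n b c p q r s : nat) :
  p * r <= q ^ 2 -> q * s <= r ^ 2 -> p * s <= q * r ->
  (b * q + (c + 2 * n) * p) * ((b + 2 * n) * s + c * r) <=
  ((b + n) * r + (c + n) * q) ^ 2.
Proof.
move=> pr qs ps.
have := leq_mul (leqnn (b * (b + 2 * n))) qs.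
have := leq_mul (leqnn (c * (c + 2 * n))) pr.
have := leq_mul (leqnn ((b + 2 * n) * (c + 2 * n))) ps.
have := (nat_Cauchy (n * q) (n * r)).1.
rewrite -!mulnn.
lia.
Qed.

Definition log_concave (a : nat -> nat) : Prop :=
  forall k, a k * a k.+2 <= a k.+1 ^ 2.

Definition zeros_final (a : nat -> nat) : Prop :=
  forall k, a k = 0 -> a k.+1 = 0.

(** Multiply two consecutive log-concavity inequalities and cancel the two
middle terms; if one of these vanishes, so does [a k.+3]. *)
Lemma log_concave_skip a k : log_concave a -> zeros_final a ->
  a k * a k.+3 <= a k.+1 * a k.+2.
Proof.
move=> lc nz.
have [/nz/nz ->|q0] := posnP (a k.+1); first by rewrite muln0.
have [/nz ->|r0] := posnP (a k.+2); first by rewrite muln0.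
rewrite -(leq_pmul2r (m := a k.+1 * a k.+2)) ?muln_gt0 ?q0 //.
have := leq_mul (lc k) (lc k.+1).
by rewrite -!mulnn; lia.
Qed.

Lemma D_log_concave d n : 0 < n -> log_concave (D d n).
Proof.
move=> n0.
suff [] : log_concave (D d n) /\ zeros_final (D d n) by [].
elim: d => [|d [lc nz]].
  by split=> k; rewrite ?[D 0 n k.+2]D_gt ?[D 0 n k.+1]D_gt ?muln0.
split=> k; last first.
  rewrite !D_succ // => /eqP.
  rewrite addn_eq0 mulSn addn_eq0 => /andP[/andP[/eqP z _] _].
  by rewrite z (nz _ z) !muln0.
have [le_dk|lt_kd] := leqP d k; first by rewrite [D _ _ k.+2]D_gt ?muln0.
rewrite !D_succ //.
(* In this range [c] is the smallest of the three decreasing coefficients, so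
   none of their subtractions is truncated. *)
have [c def_c] : exists c, n * d.+1 = n * k.+1 + 1 + c.
  by exists (n * d.+1 - (n * k.+1 + 1)); nia.
(* The term preceding [D d n k], namely 0 for [k = 0]. *)
pose p := if k is j.+1 then D d n j else 0.
have ->: (if k is j.+1 then (n * d.+1 - (n * j).+1) * D d n j else 0) =
   (c + 2 * n) * p.
  rewrite /p; case: (k) def_c => [|j] def_c; first by rewrite muln0.
  by congr (_ * _); nia.
have ->: n * d.+1 - (n * k).+1 = c + n by nia.
have ->: n * d.+1 - (n * k.+1).+1 = c by nia.
have ->: (n * k.+1).+1 = (n * k).+1 + n by nia.
have ->: (n * k.+2).+1 = (n * k).+1 + 2 * n by nia.
apply: log_concave_step; [|exact: lc|].
  by rewrite /p; case: (k) => [|j] //; apply: lc.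
by rewrite /p; case: (k) => [|j] //; apply: log_concave_skip.
Qed.

Theorem corollary1p2 (d n : nat) (hd : 1 <= d) (hn : 1 <= n) :
  forall k : nat, 1 <= k <= d - 1 ->
    D d n (k - 1) * D d n (k + 1) <= D d n k ^ 2.
Proof.
case=> [|k] // _; rewrite subn1 addn1 /=; exact: D_log_concave.
Qed.
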